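(* Let $I$ be a finite index set, $f:\mathbb{R}^n\to\overline{\mathbb{R}}$ a proper lower semicontinuous function, $g_j:\mathbb{R}^n\to\overline{\mathbb{R}}$ ($j\in I$), and suppose $\Omega:=\{x\in\mathbb{R}^n: g_j(x)\le0\ \forall j\in I\}$ is a closed convex set. Let $\bar x\in\Omega\cap\mathrm{dom}\,f$ be a local minimizer of $f$ over $\Omega$. Put $I(\bar x)=\{j\in I: g_j(\bar x)=0\}$, and let $K_j\subset\mathbb{R}^n$ with $\bar x\in K_j$, $\beta_j>0$, $\gamma_j\ge0$. Assume: (i) $\displaystyle N(\Omega,\bar x)=\bigcup_{\mu\in\mathbb{R}_+^{|I(\bar x)|}}\Big(\sum_{j\in I(\bar x):\,\mu_j>0}\mu_j\,\partial^{K_j}_{\beta_j,\gamma_j}g_j(\bar x)+\sum_{j\in I(\bar x):\,\mu_j=0}\partial^\infty g_j(\bar x)\Big)$; (ii) whenever $\mu_j\ge0$ ($j\in I(\bar x)$), $I^+:=\{j\in I(\bar x):\mu_j>0\}$, $I^0:=\{j\in I(\bar x):\mu_j=0\}$, $w\in\partial^\infty f(\bar x)$, $v_j\in\partial^{K_j}_{\beta_j,\gamma_j}g_j(\bar x)$ for $j\in I^+$, $v_j^\infty\in\partial^\infty g_j(\bar x)$ for $j\in I^0$, and $$0=w+\sum_{j\in I^+}\mu_jv_j+\sum_{j\in I^0}v_j^\infty,$$ then $w=0$, $I^+=\emptyset$, and $v_j^\infty=0$ for all $j\in I^0$. Then the generalized KKT condition holds at $\bar x$: there exist $\gamma_0>0$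 and $\mu_j\ge0$ ($j\in I(\bar x)$) with $\gamma_0+\sum_{j\in I(\bar x)}\mu_j=1$ and $$0\in\gamma_0\,\partial f(\bar x)+\sum_{j\in I(\bar x):\,\mu_j>0}\mu_j\,\partial^{K_j}_{\beta_j,\gamma_j}g_j(\bar x)+\sum_{j\in I(\bar x):\,\mu_j=0}\partial^\infty g_j(\bar x).$$
   Context: $\overline{\mathbb{R}}=\mathbb{R}\cup\{\pm\infty\}$; $\mathrm{dom}\,h=\{x: h(x)<+\infty\}$; $h$ is proper if $\mathrm{dom}\,h\neq\emptyset$ and $h>-\infty$ everywhere. $A+B$ is the Minkowski sum, $A+\emptyset=\emptyset$, and an empty sum is $\{0\}$. Strong subdifferential: for nonempty $K\subset\mathbb{R}^n$, $\beta>0$, $\gamma\ge 0$ and $\bar x\in\mathrm{dom}\,h\cap K$, $\partial^K_{\beta,\gamma}h(\bar x)$ is the set of all $\xi\in\mathbb{R}^n$ such that for all $y\in K$ and all $\lambda\in[0,1]$ $$\max\{h(y),h(\bar x)\}\ge h(\bar x)+\frac{\lambda}{\beta}\langle\xi,y-\bar x\rangle+\frac{\lambda}{2}\Big(\gamma-\frac{\lambda}{\beta}-\lambda\gamma\Big)\|y-\bar x\|^2 .$$ Regular subdifferential: $\widehat\partial h(x)=\{v: h(y)\ge h(x)+\langle v,y-x\rangle+o(\|y-x\|)\ \forall y\in\mathbb{R}^n\}$ for $x\in\mathrm{dom}\,h$, and $\emptyset$ otherwise. Limiting subdifferential: $\partial h(\bar x)=\{v:\exists\,x^k\to\bar x$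 with $h(x^k)\to h(\bar x)$ and $v^k\in\widehat\partial h(x^k)$ with $v^k\to v\}$. Horizon subdifferential: $\partial^\infty h(\bar x)=\{v:\exists\,x^k\to\bar x$ with $h(x^k)\to h(\bar x)$, $v^k\in\widehat\partial h(x^k)$ and $t_k\to0^+$ with $t_kv^k\to v\}$ (possibly empty). Normal cone: $N(\mathcal X,z)=\partial\delta_{\mathcal X}(z)$ with $\delta_{\mathcal X}$ the indicator function; for convex $\mathcal X$ and $z\in\mathcal X$ it is $\{v:\langle v,y-z\rangle\le0\ \forall y\in\mathcal X\}$. *)

(* Defs.v *)
From mathcomp Require Import all_boot all_order all_algebra.
From mathcomp Require Import all_classical all_reals all_analysis.

Set Implicit Arguments.
Unset Strict Implicit.
Unset Printing Implicit Defensive.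

Import Order.TTheory GRing.Theory Num.Theory.
Import numFieldNormedType.Exports.

Local Open Scope classical_set_scope.
Local Open Scope ring_scope.

(* R^n is 'rV[R]_n. Its library norm is the max norm, so the
   Euclidean inner product and norm are defined here; topological notions
   (neighbourhoods, limits, closedness, lower semicontinuity) do not depend on
   this choice and are the library's. *)

Definition dotv (R : realType) (n : nat) (u v : 'rV[R]_n) : R :=
  \sum_(i < n) u 0 i * v 0 i.

Definition enorm (R : realType) (n : nat) (u : 'rV[R]_n) : R :=
  Num.sqrt (dotv u u).

Definition domain (R : realType) (n : nat) (h : 'rV[R]_n -> \bar R) :
    set 'rV[R]_n :=
  [set x | (h x < +oo)%E].

Definition proper_fun (R : realType) (n : nat) (h : 'rV[R]_n -> \bar R) : Prop :=
  domain h !=set0 /\ forall x, (-oo < h x)%E.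

(* Meant for x in [domain h `&` K]. *)
Definition strong_subdiff (R : realType) (n : nat) (K : set 'rV[R]_n)
    (beta gamma : R) (h : 'rV[R]_n -> \bar R) (x : 'rV[R]_n) : set 'rV[R]_n :=
  [set xi | forall (y : 'rV[R]_n) (lambda : R),
     K y -> 0 <= lambda <= 1 ->
     (h x + (lambda / beta * dotv xi (y - x))%:E
          + (lambda / 2 * (gamma - lambda / beta - lambda * gamma)
             * enorm (y - x) ^+ 2)%:E
      <= maxe (h y) (h x))%E].

(* The remainder [r] is the term o(||y - x||). Being a little-o as y tends to x,
   it is constrained only near x; it is extended-valued so that it does not
   forbid h from taking the value -oo far away from x. *)
Definition regular_subdiff (R : realType) (n : nat) (h : 'rV[R]_n -> \bar R)
    (x : 'rV[R]_n) : set 'rV[R]_n :=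
  [set v | domain h x /\
     exists r : 'rV[R]_n -> \bar R,
       (forall e : R, 0 < e ->
          \forall y \near x, (`|r y| <= (e * enorm (y - x))%:E)%E) /\
       (forall y : 'rV[R]_n, h x + (dotv v (y - x))%:E + r y <= h y)%E].

Definition limiting_subdiff (R : realType) (n : nat) (h : 'rV[R]_n -> \bar R)
    (x : 'rV[R]_n) : set 'rV[R]_n :=
  [set v | exists (xk vk : nat -> 'rV[R]_n),
     [/\ xk k @[k --> \oo] --> x,
         h (xk k) @[k --> \oo] --> h x,
         forall k, regular_subdiff h (xk k) (vk k) &
         vk k @[k --> \oo] --> v]].

Definition horizon_subdiff (R : realType) (n : nat) (h : 'rV[R]_n -> \bar R)
    (x : 'rV[R]_n) : set 'rV[R]_n :=
  [set v | exists (xk vk : nat -> 'rV[R]_n) (tk : nat -> R),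
     [/\ xk k @[k --> \oo] --> x,
         h (xk k) @[k --> \oo] --> h x &
         forall k, regular_subdiff h (xk k) (vk k)] /\
     [/\ forall k, 0 < tk k,
         tk k @[k --> \oo] --> 0 &
         tk k *: vk k @[k --> \oo] --> v]].

Definition set_indicator (R : realType) (n : nat) (X : set 'rV[R]_n)
    (x : 'rV[R]_n) : \bar R :=
  if x \in X then 0%E else +oo%E.

Definition normal_cone (R : realType) (n : nat) (X : set 'rV[R]_n)
    (z : 'rV[R]_n) : set 'rV[R]_n :=
  limiting_subdiff (set_indicator X) z.

Definition minkowski_sum (R : realType) (n : nat) (A B : set 'rV[R]_n) : set 'rV[R]_n :=
  [set a + b | a in A & b in B].

Definition dilate_set (R : realType) (n : nat) (c : R) (A : set 'rV[R]_n) :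
    set 'rV[R]_n :=
  [set c *: a | a in A].

Definition feasible_set (R : realType) (n : nat) (I : finType)
    (g : I -> 'rV[R]_n -> \bar R) : set 'rV[R]_n :=
  [set x | forall j, (g j x <= 0)%E].

Definition active (R : realType) (n : nat) (I : finType)
    (g : I -> 'rV[R]_n -> \bar R) (x : 'rV[R]_n) : pred I :=
  fun j => g j x == 0%E.

(* Multipliers are indexed by the whole of I, but only their values at active
   indices are ever used; an empty sum is [set 0]. *)
Definition multiplier_sum (R : realType) (n : nat) (I : finType)
    (g : I -> 'rV[R]_n -> \bar R) (K : I -> set 'rV[R]_n) (beta gamma : I -> R)
    (x : 'rV[R]_n) (mu : I -> R) : set 'rV[R]_n :=
  minkowski_sum
    (\big[@minkowski_sum R n/[set 0]]_(j | active g x j && (0 < mu j))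
        dilate_set (mu j) (strong_subdiff (K j) (beta j) (gamma j) (g j) x))
    (\big[@minkowski_sum R n/[set 0]]_(j | active g x j && (mu j == 0))
        horizon_subdiff (g j) x).

(* Main.v *)
(* Minimising [f x + |x - xbar|^2 + k |x - y|^2] over x near xbar and y in Omega
   near xbar, for k large, gives points x, y close to xbar, a regular
   subgradient v of f at x and a regular normal z to Omega at y such that v + z
   is small. Let x, y tend to xbar and normalise by t = 1 / (1 + |v|): along a
   subsequence t v converges to some p with |p| = 1 - lim t. If lim t = 0, then p
   is a unit horizon subgradient of f with -p normal to Omega, which the
   qualification condition excludes; otherwise v converges to a subgradient of f
   whose opposite is normal to Omega, and the formula for the normal cone, after
   rescaling the multipliers, is the KKT condition. *)
Require Import Defs.
From mathcomp Require Import all_boot all_order all_algebra.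
From mathcomp Require Import all_classical all_reals all_analysis.
From mathcomp Require Import lra ring.

Import Order.TTheory GRing.Theory Num.Theory.
Import numFieldNormedType.Exports.

Local Open Scope classical_set_scope.
Local Open Scope ring_scope.

Set Implicit Arguments.
Unset Strict Implicit.
Unset Printing Implicit Defensive.

(** * The Euclidean inner product and the library topology *)

Lemma cvg_dotv (R : realType) (n : nat) (T : Type) (F : set_system T)
    {FF : Filter F} (u v : T -> 'rV[R]_n) (a b : 'rV[R]_n) :
  u @ F --> a -> v @ F --> b -> dotv (u t) (v t) @[t --> F] --> dotv a b.
Proof.
move=> ua vb; rewrite /dotv.
apply: cvg_big => [|i _]; first exact: add_continuous.
have coordE (w : T -> 'rV[R]_n) (c : 'rV[R]_n) :
    w @ F --> c -> w t 0 i @[t --> F] --> c 0 i.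
  move=> wc.
  exact: (@cvg_comp _ _ _ w (fun M => M 0 i) F _ _ wc
    (@coord_continuous R _ _ 0 i c)).
by apply: cvgM; exact: coordE.
Qed.

Lemma dotvC (R : realType) (n : nat) (u v : 'rV[R]_n) : dotv u v = dotv v u.
Proof. by apply: eq_bigr => i _; rewrite mulrC. Qed.

Lemma dotvDl (R : realType) (n : nat) (u v w : 'rV[R]_n) :
  dotv (u + v) w = dotv u w + dotv v w.
Proof. by rewrite -big_split; apply: eq_bigr => i _; rewrite mxE mulrDl. Qed.

Lemma dotvZl (R : realType) (n : nat) (c : R) (u v : 'rV[R]_n) :
  dotv (c *: u) v = c * dotv u v.
Proof. by rewrite mulr_sumr; apply: eq_bigr => i _; rewrite mxE mulrA. Qed.

Lemma dotvNl (R : realType) (n : nat) (u v : 'rV[R]_n) :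
  dotv (- u) v = - dotv u v.
Proof. by rewrite -scaleN1r dotvZl mulN1r. Qed.

Lemma dot0v (R : realType) (n : nat) (u : 'rV[R]_n) : dotv 0 u = 0.
Proof. by rewrite -(scale0r 0) dotvZl mul0r. Qed.

Lemma dotvv_ge0 (R : realType) (n : nat) (u : 'rV[R]_n) : 0 <= dotv u u.
Proof. by apply: sumr_ge0 => i _; rewrite -expr2 sqr_ge0. Qed.

(** The max norm is attained at a coordinate whose square is one of the nonnegative summands of
    [dotv u u]. This turns Euclidean estimates into convergence in the library norm. *)
Lemma sqr_norm_le_dotvv (R : realType) (n : nat) (u : 'rV[R]_n) :
  `|u| ^+ 2 <= dotv u u.
Proof.
have [->|u0] := eqVneq u 0; first by rewrite normr0 expr0n dotvv_ge0.
have /mx_norm_neq0 [[i j] /= uE] : mx_norm u != 0 by rewrite -[mx_norm u]/`|u| normr_eq0.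
rewrite [`|u|]uE real_normK ?num_real// (ord1 i) /dotv (bigD1 j)//= -expr2 lerDl.
by apply: sumr_ge0 => k _; rewrite -expr2 sqr_ge0.
Qed.

Lemma dotvv_gt0 (R : realType) (n : nat) (u : 'rV[R]_n) : u != 0 -> 0 < dotv u u.
Proof.
by move=> u0; apply: lt_le_trans (sqr_norm_le_dotvv u); rewrite exprn_gt0 ?normr_gt0.
Qed.

Lemma enorm_sqr (R : realType) (n : nat) (u : 'rV[R]_n) : enorm u ^+ 2 = dotv u u.
Proof. by rewrite sqr_sqrtr ?dotvv_ge0. Qed.

Lemma dotvv_sub (R : realType) (n : nat) (x y a : 'rV[R]_n) :
  dotv (y - a) (y - a) =
  dotv (x - a) (x - a) + 2 * dotv (x - a) (y - x) + dotv (y - x) (y - x).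
Proof.
rewrite /dotv mulr_sumr -!big_split; apply: eq_bigr => i _ /=.
by rewrite !mxE; ring.
Qed.

Lemma near_enorm_le (R : realType) (n : nat) (x : 'rV[R]_n) (e : R) :
  0 < e -> \forall y \near x, enorm (y - x) <= e.
Proof.
move=> e0.
have yx : y - x @[y --> x] --> (0 : 'rV[R]_n).
  by rewrite -(subrr x); apply: (@cvgB _ _ _ (nbhs x) _ id (cst x));
    [exact: cvg_id|exact: cvg_cst].
have dx : dotv (y - x) (y - x) @[y --> x] --> (0 : R).
  by rewrite -(dot0v (0 : 'rV[R]_n)); apply: (@cvg_dotv _ _ _ (nbhs x)).
near=> y.
have : dotv (y - x) (y - x) <= e ^+ 2.
  by apply: ltW; near: y; apply: (cvgr_lt _ dx); rewrite exprn_gt0.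
by rewrite -enorm_sqr ler_sqr ?nnegrE ?sqrtr_ge0 ?(ltW e0).
Unshelve. all: by end_near.
Qed.

(** * Compactness: subsequences and attained minima *)

(** Beyond every [k], some term lies within [1/(k+1)] of a cluster point [p]. The bound [k <= s k]
    takes the place of monotonicity when limits are carried over. *)
Lemma compact_seq_subcvg (R : realType) (V : pseudoMetricNormedZmodType R)
    (A : set V) (u : nat -> V) :
  compact A -> (forall k, A (u k)) ->
  exists (p : V) (s : nat -> nat),
    [/\ A p, forall k, (k <= s k)%N & u (s k) @[k --> \oo] --> p].
Proof.
move=> cA Au.
have [|p [Ap clp]] := cA (u @ \oo) _; first by exists 0%N => // k _; exact: Au.
have /choice[s sP] k : exists m, (k <= m)%N /\ `|p - u m| < k.+1%:R^-1.
  have [||_ [[m km <-] pm]] := clp (u @` [set m | (k <= m)%N]) (ball p k.+1%:R^-1).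
  - by exists k => // m /= km; exists m.
  - by apply: nbhsx_ballx; rewrite invr_gt0.
  - by exists m; split=> //; move: pm; rewrite -ball_normE.
exists p, s; split => // [k|]; first by case: (sP k).
apply/cvgrPdist_lt => e e0.
have [N _ Ne] := near_infty_natSinv_lt (PosNum e0).
exists N => // k Nk; apply: lt_trans (Ne k Nk); exact: (sP k).2.
Qed.

Lemma cvg_subseq (T : Type) (s : nat -> nat) (u : nat -> T) (F : set_system T) :
  (forall k, (k <= s k)%N) -> u @ \oo --> F -> u (s k) @[k --> \oo] --> F.
Proof.
move=> sk uF A /uF [N _ NA]; exists N => // k Nk.
by apply: NA => /=; exact: leq_trans (sk k).
Qed.

(** If the infimum [m] were not attained, the sublevel sets above [m] would generate a proper filter
    on [A]. It clusters at some [p] with [m < F p], and semicontinuity separates [p] from one of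
    these sets. *)
Lemma lsc_compact_argmin (R : realType) (T : topologicalType) (F : T -> \bar R)
    (A : set T) :
  compact A -> A !=set0 -> lower_semicontinuous F ->
  exists2 p, A p & forall q, A q -> (F p <= F q)%E.
Proof.
move=> cA [a0 Aa0] lscF.
have [[p Ap Fp]|/forall2NP noinf] :=
    pselect (exists2 p, A p & (F p <= ereal_inf (F @` A))%E).
  by exists p => // q Aq; apply: le_trans Fp _; apply: ereal_inf_lbound; exists q.
pose m := ereal_inf (F @` A); pose S b := A `&` [set x | (F x < b)%E].
have mF q : A q -> (m < F q)%E.
  by move=> Aq; have [//|/negP] := noinf q; rewrite -ltNge.
have ffS : Filter (filter_from [set b | (m < b)%E] S).
  apply: filter_from_filter; first by exists (F a0); exact: mF.
  move=> b c mb mc; exists (mine b c); first by rewrite /= lt_min; apply/andP.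
  by move=> x [Ax /=]; rewrite lt_min => /andP[xb xc].
have pfS : ProperFilter (filter_from [set b | (m < b)%E] S).
  apply: filter_from_proper => b /= /ereal_inf_lt[_ [x Ax <-] xb].
  by exists x.
have [|p [Ap clp]] := cA _ pfS.
  by exists (F a0); [exact: mF|move=> x []].
(* Semicontinuity is tested at real thresholds only, while [m] and [F p] may be infinite. *)
have [r mr rp] : exists2 r : R, (m < r%:E)%E & (r%:E < F p)%E.
  have := mF p Ap; move: (m) (F p) => [b| |] [c| |]//= bc.
  - by exists ((b + c) / 2); rewrite !lte_fin; move: bc; rewrite lte_fin => bc; lra.
  - by exists (b + 1); rewrite ?ltry// lte_fin; lra.
  - by exists (c - 1); rewrite ?ltNyr// lte_fin; lra.
  - by exists 0; rewrite ?ltry ?ltNyr.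
have [V Vp rV] := lscF p r rp.
have [|x [[_ /= xr] /rV]] := clp (S r%:E) V _ Vp; first by exists r%:E.
by rewrite ltNge (ltW xr).
Qed.

(** * Regular subgradients and regular normals *)

(** The quadratic term is at most [e |y - x|] once [|y - x| <= e / (c + 1)], so it is an admissible
    remainder. The subgradient inequality must hold globally but is given only near [x], so the
    remainder is set to [-oo] wherever it fails. *)
Lemma regular_subdiff_quadratic (R : realType) (n : nat) (h : 'rV[R]_n -> \bar R)
    (x v : 'rV[R]_n) (c : R) :
  domain h x -> 0 <= c ->
  (\forall y \near x,
     (h x + (dotv v (y - x))%:E + (- (c * dotv (y - x) (y - x)))%:E <= h y)%E) ->
  regular_subdiff h x v.
Proof.
move=> hx c0 hv; split=> //.
exists (fun y =>
  if (h x + (dotv v (y - x))%:E + (- (c * dotv (y - x) (y - x)))%:E <= h y)%E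
  then (- (c * dotv (y - x) (y - x)))%:E else -oo%E); split; last first.
  by move=> y; case: ifPn => // _; rewrite addeNy leNye.
move=> e e0.
have c1 : 0 < c + 1 by lra.
have := near_enorm_le x (divr_gt0 e0 c1).
apply: filterS2 hv => y -> ye.
rewrite abse_EFin lee_fin normrN ger0_norm ?mulr_ge0 ?dotvv_ge0//.
rewrite -enorm_sqr expr2 mulrA ler_wpM2r ?sqrtr_ge0//.
move: ye; rewrite ler_pdivlMr// mulrDr mulr1 mulrC => ye.
by have := sqrtr_ge0 (dotv (y - x) (y - x)); rewrite -/(enorm _); lra.
Qed.

(** Multiplying the inequality by [c] does not affect the values 0 and [+oo] of the indicator; only
    the remainder is rescaled. *)
Lemma regular_subdiff_indicator_scale (R : realType) (n : nat)
    (C : set 'rV[R]_n) (x v : 'rV[R]_n) (c : R) :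
  0 < c -> regular_subdiff (set_indicator C) x v ->
  regular_subdiff (set_indicator C) x (c *: v).
Proof.
move=> c0 [Cx [r [rsmall rle]]]; split=> //.
have xE : set_indicator C x = 0%E.
  by move: Cx; rewrite /domain /set_indicator /=; case: ifP.
exists (fun y => (c%:E * r y)%E); split=> [e e0|y].
  apply: filterS (rsmall (e / c) (divr_gt0 e0 c0)) => y re.
  rewrite abseM gee0_abs ?lee_fin ?(ltW c0)//.
  apply: (@le_trans _ _ (c%:E * (e / c * enorm (y - x))%:E)%E).
    by apply: lee_wpmul2l => //; rewrite lee_fin ltW.
  by rewrite -EFinM lee_fin mulrA (mulrC c) divfK ?gt_eqF.
move: (rle y); rewrite xE !add0e dotvZl /set_indicator; case: ifP => _; last first.
  by rewrite !leey.
move=> vr; have c0' : (0 <= c%:E)%E by rewrite lee_fin ltW.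
by have := lee_wpmul2l c0' vr; rewrite mule0 muleDr ?fin_num_adde_defr.
Qed.

(** * Semicontinuity of the penalised objective *)

Lemma dotvv_subC (R : realType) (n : nat) (a b : 'rV[R]_n) :
  dotv (a - b) (a - b) = dotv (b - a) (b - a).
Proof. by rewrite -(opprB b a) dotvNl dotvC dotvNl opprK. Qed.

Lemma dotvv_sub_continuous (R : realType) (n : nat) (a : 'rV[R]_n) :
  continuous (fun x : 'rV[R]_n => dotv (x - a) (x - a)).
Proof.
move=> x; have xa : y - a @[y --> x] --> x - a.
  by apply: (@cvgB _ _ _ (nbhs x) _ id (cst a)); [exact: cvg_id|exact: cvg_cst].
exact: (@cvg_dotv _ _ _ (nbhs x)).
Qed.

Lemma lsc_comp (R : realType) (S T : topologicalType) (phi : S -> T)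
    (f : T -> \bar R) :
  continuous phi -> lower_semicontinuous f -> lower_semicontinuous (f \o phi).
Proof.
move=> cphi lscf x a /lscf[V Vx aV]; exists (phi @^-1` V) => [|y /aV//].
exact: cphi.
Qed.

Lemma lscD_continuous (R : realType) (T : topologicalType) (f : T -> \bar R)
    (g : T -> R) :
  lower_semicontinuous f -> continuous g ->
  lower_semicontinuous (fun x => (f x + (g x)%:E)%E).
Proof.
move=> lscf cg x a afg.
(* The slack in [a < f x + g x] is shared out: [b] is the midpoint of [a - g x] and [f x], or
   [a - g x + 1] when [f x] is infinite. *)
have [b bf abg] : exists2 b, (b%:E < f x)%E & a - b < g x.
  move: afg; case: (f x) => [r| |//].
    rewrite -EFinD lte_fin => afg.
    by exists ((r + a - g x) / 2); [rewrite lte_fin|]; lra.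
  by move=> _; exists (a - g x + 1); [exact: ltry|lra].
have [V Vx bV] := lscf x b bf.
exists (V `&` [set y | a - b < g y]).
  by apply: filterI => //; exact: (@cvgr_gt _ _ (nbhs x) _ g _ (cg x)).
move=> y [/bV /= bfy abgy]; case: (f y) bfy => [r||//]; last by move=> _; exact: ltry.
by rewrite -EFinD !lte_fin => br; lra.
Qed.

(** * Quadratic penalty and the approximate Fermat rule *)

(** Otherwise each weight admits a pair that is not [d]-close. Along a subsequence the [x k] tend to
    some [p]; the penalty forces [x k - y k] to 0, so [p] lies in [C] and [f p >= F]. The proximal
    term then forces [p = xbar], so both points end up [d]-close after all. *)
Lemma penalty_localizes (R : realType) (n : nat) (f : 'rV[R]_n -> \bar R)
    (B C : set 'rV[R]_n) (xbar : 'rV[R]_n) (F d : R) :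
  (forall x, (-oo < f x)%E) -> lower_semicontinuous f ->
  compact B -> closed C -> f xbar = F%:E -> 0 < d ->
  (forall y, B y -> C y -> (F%:E <= f y)%E) ->
  exists k : nat, forall x y, B x -> C y ->
    (f x + (dotv (x - xbar) (x - xbar) + k.+1%:R * dotv (x - y) (x - y))%:E
      <= F%:E)%E ->
    `|x - xbar| < d /\ `|y - xbar| < d.
Proof.
move=> finf lscf cB clC fF d0 Fmin; apply: contrapT => /forallNP noloc.
have {noloc} /choice[w wP] (k : nat) : exists w : 'rV[R]_n * 'rV[R]_n,
    [/\ B w.1, C w.2,
     (f w.1 + (dotv (w.1 - xbar) (w.1 - xbar) +
        k.+1%:R * dotv (w.1 - w.2) (w.1 - w.2))%:E <= F%:E)%E &
     ~ (`|w.1 - xbar| < d /\ `|w.2 - xbar| < d)].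
  have /existsNP[x /existsNP[y /not_implyP[Bx /not_implyP[Cy]]]] := noloc k.
  move=> /not_implyP[le nd].
  by exists (x, y).
have [p [s [Bp sk xp]]] :=
    compact_seq_subcvg (u := fun k => (w k).1) cB
      (fun k => let: And4 Bx _ _ _ := wP k in Bx).
pose x k := (w (s k)).1; pose y k := (w (s k)).2.
have xyP k : [/\ B (x k), C (y k),
    (f (x k) + (dotv (x k - xbar) (x k - xbar) +
       k.+1%:R * dotv (x k - y k) (x k - y k))%:E <= F%:E)%E &
    ~ (`|x k - xbar| < d /\ `|y k - xbar| < d)].
  (* Since [k <= s k], lowering the weight from [(s k).+1] to [k.+1] preserves the inequality. *)
  have [Bx Cy le nd] := wP (s k); split=> //; apply: le_trans le.
  rewrite leeD2l// lee_fin lerD2l ler_wpM2r ?dotvv_ge0// ler_nat ltnS.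
  exact: sk.
have {wP}xp : x k @[k --> \oo] --> p by [].
have near_lt a : (a%:E < f p)%E -> \forall k \near \oo, exists2 r, f (x k) = r%:E & a < r.
  move=> /lscf[V Vp aV]; near=> k.
  have /aV : V (x k) by near: k; exact: xp.
  have [_ _ + _] := xyP k; case: (f (x k)) => [r _|//|//].
  by rewrite lte_fin => ar; exists r.
have xy0 : x k - y k @[k --> \oo] --> (0 : 'rV[R]_n).
  have [a af] : exists a : R, (a%:E < f p)%E.
    move: (finf p); case: (f p) => [r||//] _; last by exists 0; rewrite ltry.
    by exists (r - 1); rewrite lte_fin; lra.
  apply/cvgr0Pnorm_lt => e e0.
  (* As [f (x k) > a], the penalty term stays below [F - a]; the absolute value plus 1 makes a
     positive bound to divide by. *)
  have M0 : 0 < `|F - a| + 1 by have := normr_ge0 (F - a); lra.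
  have c0 : 0 < e ^+ 2 / (`|F - a| + 1) by rewrite divr_gt0 ?exprn_gt0.
  near=> k.
  have [r fr ar] : exists2 r, f (x k) = r%:E & a < r by near: k; exact: near_lt.
  have [_ _ + _] := xyP k; rewrite fr -EFinD lee_fin => le.
  have kM : (`|F - a| + 1) / k.+1%:R < e ^+ 2.
    rewrite mulrC -ltr_pdivlMr//; near: k.
    exact: (near_infty_natSinv_lt (PosNum c0)).
  rewrite -ltr_sqr ?nnegrE ?(ltW e0)//.
  apply: le_lt_trans (sqr_norm_le_dotvv _) (le_lt_trans _ kM).
  rewrite ler_pdivlMr ?ltr0n// mulrC.
  have := dotvv_ge0 (x k - xbar); have := ler_norm (F - a); lra.
have yp : y k @[k --> \oo] --> p.
  rewrite -(subr0 p) (_ : y = fun k => x k - (x k - y k)); first exact: cvgB.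
  by apply/funext => k; rewrite subKr.
have Cp : C p.
  by apply: (closed_cvg _ clC _ _ yp); apply: nearW => k; case: (xyP k).
have [px|px] := eqVneq p xbar.
  have [k [xd yd]] : exists k, `|x k - xbar| < d /\ `|y k - xbar| < d.
    apply: (@filter_ex _ \oo); rewrite -px; near=> k.
    by rewrite !(distrC _ p); split; near: k; apply: cvgr_dist_lt.
  by case: (xyP k) => _ _ _ [].
(* If [p] differs from [xbar], then eventually [f (x k) > F - q / 2] while the proximal term exceeds
   [q / 2]: their sum exceeds [F]. *)
pose q := dotv (p - xbar) (p - xbar).
have q0 : 0 < q by rewrite dotvv_gt0// subr_eq0.
have Fqf : ((F - q / 2)%:E < f p)%E.
  by apply: lt_le_trans (Fmin p Bp Cp); rewrite lte_fin; lra.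
have xq : dotv (x k - xbar) (x k - xbar) @[k --> \oo] --> q.
  exact: (cvg_comp _ _ xp (@dotvv_sub_continuous _ _ xbar p)).
have [k [[r fr rq] qx]] : exists k,
    (exists2 r, f (x k) = r%:E & F - q / 2 < r) /\
    q / 2 < dotv (x k - xbar) (x k - xbar).
  apply: (@filter_ex _ \oo); apply: filterI; first exact: near_lt.
  by apply: (cvgr_gt _ xq); lra.
have [_ _ + _] := xyP k; rewrite fr -EFinD lee_fin => le.
have : 0 <= k.+1%:R * dotv (x k - y k) (x k - y k) by rewrite mulr_ge0 ?dotvv_ge0.
lra.
Unshelve. all: by end_near.
Qed.

Lemma compact_closed_ball (R : realType) (n : nat) (x : 'rV[R]_n) (r : R) :
  0 < r -> compact (closed_ball x r).
Proof.
move=> r0; apply: bounded_closed_compact; last exact: closed_ball_closed.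
exists (`|x| + r); split; first exact: num_real.
move=> M xrM y; rewrite closed_ballE// /closed_ball_ /= => xy.
by have := ler_normD (y - x) x; rewrite subrK -[`|y - x|]distrC; lra.
Qed.

(** The penalised objective has a minimizer over [B] times [B] intersected with [C], interior to [B]
    in both variables. Minimality in [x] alone gives [v], in [y] alone gives [z], and the penalty
    gradients cancel in [v + z]. *)
Lemma fuzzy_fermat (R : realType) (n : nat) (f : 'rV[R]_n -> \bar R)
    (C : set 'rV[R]_n) (xbar : 'rV[R]_n) (e : R) :
  (forall x, (-oo < f x)%E) -> lower_semicontinuous f -> closed C -> C xbar ->
  domain f xbar -> (\forall y \near xbar, C y -> (f xbar <= f y)%E) -> 0 < e ->
  exists x y v z : 'rV[R]_n,
    [/\ `|x - xbar| < e, `|y - xbar| < e &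
        (f xbar - e%:E <= f x <= f xbar)%E] /\
    [/\ regular_subdiff f x v, regular_subdiff (set_indicator C) y z &
        `|v + z| < e].
Proof.
move=> finf lscf clC Cxbar fdom fmin e0.
have [F fF] : exists F, f xbar = F%:E.
  by move: (finf xbar) fdom; rewrite /domain /=; case: (f xbar) => [F||]//; exists F.
have /lscf[W Wx eW] : ((F - e)%:E < f xbar)%E by rewrite fF lte_fin; lra.
have /nbhs_ballP[r /= r0 rP] : nbhs xbar
  ([set y | C y -> (f xbar <= f y)%E] `&` W) by exact: filterI.
pose rho := r / 2; have rho0 : 0 < rho by rewrite divr_gt0.
pose B := closed_ball xbar rho.
have BE y : B y <-> `|y - xbar| <= rho.
  by rewrite /B closed_ballE// /closed_ball_ /= distrC.
have Bball y : B y -> ball xbar r y.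
  by move=> /BE yr; rewrite -ball_normE /ball_ /= distrC; move: yr; rewrite /rho; lra.
have Bnbhs y : `|y - xbar| < rho -> nbhs y B.
  move=> yr; apply: (@filterS _ (nbhs y) _ (ball xbar rho)).
    by move=> t; rewrite -ball_normE /ball_ /= => /ltW; rewrite distrC => /BE.
  apply: open_nbhs_nbhs; split; first exact: ball_open.
  by rewrite -ball_normE /ball_ /= distrC.
(* The bound [rho] keeps [x] and [y] inside [B]; the bound [e / 2] makes [2 (x - xbar)] smaller than
   [e]. *)
pose d := Num.min rho (e / 2).
have d0 : 0 < d by rewrite lt_min rho0 divr_gt0.
have cB : compact B by exact: compact_closed_ball.
have Fmin y : B y -> C y -> (F%:E <= f y)%E.
  by move=> /Bball/rP[+ _] Cy => /(_ Cy); rewrite fF.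
have [k kP] := penalty_localizes finf lscf cB clC fF d0 Fmin.
pose K : R := k.+1%:R; have K0 : 0 <= K by exact: ler0n.
pose g (p : 'rV[R]_n * 'rV[R]_n) :=
  dotv (p.1 - xbar) (p.1 - xbar) + K * dotv (p.1 - p.2) (p.1 - p.2).
have cg : continuous g.
  move=> p; apply: cvgD.
    exact: (@cvg_comp _ _ _ fst (fun x => dotv (x - xbar) (x - xbar)) (nbhs p) _ _
      cvg_fst (@dotvv_sub_continuous _ _ xbar p.1)).
  apply: cvgM; first exact: cvg_cst.
  have pp : q.1 - q.2 @[q --> p] --> p.1 - p.2.
    by apply: cvgB; [exact: cvg_fst|exact: cvg_snd].
  exact: (@cvg_dotv _ _ _ (nbhs p)).
have lscg : lower_semicontinuous (fun p => (f p.1 + (g p)%:E)%E).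
  apply: lscD_continuous => //; apply: (lsc_comp (phi := fst)) => // p.
  exact: cvg_fst.
have cBC : compact (B `&` C).
  apply: (subclosed_compact _ cB) => //; apply: closedI => //.
  exact: closed_ball_closed.
have Bx : B xbar by apply/BE; rewrite subrr normr0 ltW.
have [|[x y] /= [Bx0 [By0 Cy0]] xymin] :=
    lsc_compact_argmin (compact_setX cB cBC) _ lscg.
  by exists (xbar, xbar).
have xyF : (f x + (g (x, y))%:E <= F%:E)%E.
  by have := xymin (xbar, xbar); rewrite /g /= fF subrr !dot0v mulr0 !addr0; apply.
have [xd yd] := kP x y Bx0 Cy0 xyF.
have [fx fxE] : exists fx, f x = fx%:E.
  by move: (finf x) xyF; case: (f x) => [s||]//; exists s.
have g0 q : 0 <= g q by rewrite addr_ge0 ?mulr_ge0 ?dotvv_ge0.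
have [xrho xe] : `|x - xbar| < rho /\ `|x - xbar| < e / 2.
  by move: xd; rewrite lt_min => /andP.
have [yrho ye] : `|y - xbar| < rho /\ `|y - xbar| < e / 2.
  by move: yd; rewrite lt_min => /andP.
(* [v] and [z] are the negated partial gradients of [g], so [v + z = - 2 (x - xbar)]. *)
exists x, y, (- (2 *: (x - xbar) + (2 * K) *: (x - y))), ((2 * K) *: (x - y)).
split; split.
- lra.
- lra.
- apply/andP; split.
    by rewrite fF -EFinB ltW// eW//; have [] := rP x (Bball x Bx0).
  rewrite fF; apply: le_trans xyF; rewrite leeDl// lee_fin; exact: g0.
(* [1 + K] is the second-order coefficient of [g] in its first variable; for the second variable it
   is [K]. *)
- apply: (@regular_subdiff_quadratic _ _ _ _ _ (1 + K)); [|lra|].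
    by rewrite /domain /= fxE ltry.
  apply: filterS (Bnbhs x xrho) => t Bt.
  have := xymin (t, y); rewrite /= => /(_ _).
  rewrite fxE /g /=.
  rewrite (dotvv_sub x t xbar) (dotvv_sub x t y) dotvNl
    [in dotv (_ + _ *: _) _]dotvDl !dotvZl.
  case: (f t) (finf t) => [ft||]// _ => [|_]; last by rewrite leey.
  rewrite -!EFinD !lee_fin => /(_ (conj Bt (conj By0 Cy0))).
  set a := dotv (t - x) _; set b := dotv (x - xbar) (t - x).
  set c := dotv (x - y) (t - x).
  set u := dotv (x - xbar) _; set w := dotv (x - y) (x - y); nra.
- apply: (@regular_subdiff_quadratic _ _ _ _ _ K) => //.
    by rewrite /domain /= /set_indicator mem_set// ltry.
  apply: filterS (Bnbhs y yrho) => t Bt.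
  rewrite /set_indicator (mem_set Cy0); case: ifPn => [/set_mem Ct|];
    last by rewrite leey.
  have := xymin (x, t) (conj Bx0 (conj Bt Ct)); rewrite fxE /g /=.
  rewrite (dotvv_subC x t) (dotvv_subC x y) (dotvv_sub y t x) dotvZl.
  rewrite -(opprB y x) dotvNl add0e -!EFinD !lee_fin; nra.
- by rewrite opprD addrNK normrN normrZ ger0_norm//; lra.
Qed.

(** * Passage to the limit: the exact Fermat rule *)

Lemma limiting_fermat (R : realType) (n : nat) (f : 'rV[R]_n -> \bar R)
    (C : set 'rV[R]_n) (xbar : 'rV[R]_n) :
  (forall x, (-oo < f x)%E) -> lower_semicontinuous f -> closed C -> C xbar ->
  domain f xbar -> (\forall y \near xbar, C y -> (f xbar <= f y)%E) ->
  (forall w, horizon_subdiff f xbar w -> normal_cone C xbar (- w) -> w = 0) ->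
  exists2 v, limiting_subdiff f xbar v & normal_cone C xbar (- v).
Proof.
move=> finf lscf clC Cx fdom fmin qual.
pose eps (k : nat) : R := k.+1%:R^-1.
have eps0 k : 0 < eps k by rewrite invr_gt0.
have /choice[x /choice[y /choice[v /choice[z xyvz]]]] k :=
  fuzzy_fermat finf lscf clC Cx fdom fmin (eps0 k).
have near_eps e : 0 < e -> \forall k \near \oo, eps k < e.
  by move=> e0; exact: (near_infty_natSinv_lt (PosNum e0)).
have xx : x k @[k --> \oo] --> xbar.
  apply/cvgrPdist_lt => e /near_eps; apply: filterS => k; apply: lt_trans.
  by rewrite distrC; case: (xyvz k) => [[]].
have yx : y k @[k --> \oo] --> xbar.
  apply/cvgrPdist_lt => e /near_eps; apply: filterS => k; apply: lt_trans.
  by rewrite distrC; case: (xyvz k) => [[]].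
have vz0 : v k + z k @[k --> \oo] --> (0 : 'rV[R]_n).
  apply/cvgr0Pnorm_lt => e /near_eps; apply: filterS => k; apply: lt_trans.
  by case: (xyvz k) => _ [].
have fx : f (x k) @[k --> \oo] --> f xbar.
  have [F fF] : exists F, f xbar = F%:E.
    move: (finf xbar) fdom; rewrite /domain /=.
    by case: (f xbar) => [F||]//; exists F.
  apply: (@squeeze_cvge _ _ _ _ (fun k => (F - eps k)%:E) _ (cst F%:E)).
  - by apply: nearW => k; case: (xyvz k) => [[_ _ +] _]; rewrite fF.
  - rewrite fF; apply: cvg_EFin; first exact: nearW.
    by rewrite -[X in _ --> X]subr0; apply: cvgB; [exact: cvg_cst|exact: cvg_harmonic].
  - by rewrite fF; exact: cvg_cst.
have yI k : set_indicator C (y k) = 0%E.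
  case: (xyvz k) => _ [_ [+ _] _]; rewrite /domain /set_indicator /=.
  by case: ifP.
have xI : set_indicator C xbar = 0%E by rewrite /set_indicator mem_set.
(* This factor gives [|t v| = 1 - t]: the vectors [t v] stay in the unit ball, and their limit [p]
   determines the limit of [t] as [1 - |p|]. *)
pose t k := (1 + `|v k|)^-1.
have t0 k : 0 < t k by rewrite invr_gt0; have := normr_ge0 (v k); lra.
have tv k : `|t k *: v k| = 1 - t k.
  have t0' : 1 + `|v k| != 0 by have := t0 k; rewrite invr_gt0 => /gt_eqF ->.
  by rewrite normrZ ger0_norm ?(ltW (t0 k))// /t; field.
have [|p [s [_ sk tvp]]] := compact_seq_subcvg (u := fun k => t k *: v k)
    (compact_closed_ball (x := 0) (@ltr01 R)).
  move=> k; rewrite closed_ballE// /closed_ball_ /= sub0r normrN tv.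
  by have := t0 k; lra.
have {}xx := cvg_subseq sk xx; have {}yx := cvg_subseq sk yx.
have {}vz0 := cvg_subseq sk vz0; have {}fx := cvg_subseq sk fx.
have vsub k : regular_subdiff f (x (s k)) (v (s k)) by case: (xyvz (s k)) => _ [].
have zsub k : regular_subdiff (set_indicator C) (y (s k)) (z (s k)).
  by case: (xyvz (s k)) => _ [].
(* Regular normals may be rescaled by any positive factors; this is used with the factors [t] in the
   unbounded case and with 1 in the bounded one. *)
have normalI (c : nat -> R) (q : 'rV[R]_n) : (forall k, 0 < c k) ->
    c k *: z (s k) @[k --> \oo] --> q -> normal_cone C xbar q.
  move=> c0 cq; exists (fun k => y (s k)), (fun k => c k *: z (s k)); split=> //.
    by rewrite xI; under eq_fun do rewrite yI; exact: cvg_cst.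
  by move=> k; exact: regular_subdiff_indicator_scale.
have tp : t (s k) @[k --> \oo] --> 1 - `|p|.
  rewrite (_ : (fun k => t (s k)) = fun k => 1 - `|t (s k) *: v (s k)|).
    by apply: cvgB; [exact: cvg_cst|exact: cvg_norm].
  by apply/funext => k; rewrite tv subKr.
have : 0 <= 1 - `|p|.
  apply: (@closed_cvg _ _ \oo _ _ [set r : R | 0 <= r] _ _ _ tp).
    exact: closed_ge.
  by apply: nearW => k; exact: ltW.
rewrite le_eqVlt => /orP[/eqP p1|p1].
  exfalso.
  have p0 : p = 0.
    apply: qual.
      exists (fun k => x (s k)), (fun k => v (s k)), (fun k => t (s k)).
      by split=> //; split=> //; rewrite p1.
    apply: (normalI (fun k => t (s k))) => //.
    (* Here [t z = t (v + z) - t v] tends to [0 - p], which makes [- p] normal. *)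
    rewrite (_ : (fun k => _) =
      fun k => t (s k) *: (v (s k) + z (s k)) - t (s k) *: v (s k)); last first.
      by apply/funext => k; rewrite scalerDr addrAC subrr add0r.
    rewrite -[- p]add0r; apply: cvgB => //.
    by rewrite -(scale0r (0 : 'rV[R]_n)); apply: cvgZ => //; rewrite p1.
  by move: p1; rewrite p0 normr0 subr0 => /eqP; rewrite eq_sym oner_eq0.
(* Here [t] has a positive limit, so dividing by it recovers the convergence of [v] itself. *)
have vp : v (s k) @[k --> \oo] --> (1 - `|p|)^-1 *: p.
  rewrite (_ : (fun k => _) = fun k => (t (s k))^-1 *: (t (s k) *: v (s k))).
    by apply: cvgZ => //; apply: cvgV => //; rewrite gt_eqF.
  by apply/funext => k; rewrite scalerA mulVf ?scale1r// gt_eqF.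
exists ((1 - `|p|)^-1 *: p); first by exists (fun k => x (s k)), (fun k => v (s k)).
apply: (normalI (cst 1)) => //=.
rewrite (_ : (fun k => _) = fun k => (v (s k) + z (s k)) - v (s k)); last first.
  by apply/funext => k; rewrite scale1r addrAC subrr add0r.
by rewrite -[X in _ --> X]add0r; apply: cvgB.
Qed.

(** * Minkowski sums and rescaling of multipliers *)

Lemma big_minkowski_sumP (R : realType) (n : nat) (I : finType) (P : pred I)
    (A : I -> set 'rV[R]_n) (z : 'rV[R]_n) :
  (\big[@minkowski_sum R n/[set 0]]_(j | P j) A j) z <->
  exists2 a : I -> 'rV[R]_n, (forall j, P j -> A j (a j)) & z = \sum_(j | P j) a j.
Proof.
split=> [|[a Aa ->]]; last first.
  apply: (@big_ind2 _ _ (fun x (X : set _) => X x) 0 +%R [set 0]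
    (@minkowski_sum R n)) => // x X y Y Xx Yy.
  by exists x => //; exists y.
(* Induction runs over duplicate-free lists, so that redefining the selection at the head index
   leaves the tail unchanged. *)
suff H (r : seq I) : uniq r -> (\big[@minkowski_sum R n/[set 0]]_(j <- r | P j) A j) z ->
    exists2 a : I -> 'rV[R]_n, (forall j, j \in r -> P j -> A j (a j)) &
      z = \sum_(j <- r | P j) a j.
  move=> /H[|a Aa ->]; first exact: index_enum_uniq.
  by exists a => // j; apply: Aa; exact: mem_index_enum.
elim: r z => [z _|i r IH z /= /andP[ir ur]].
  by rewrite big_nil => ->; exists (fun=> 0) => //; rewrite big_nil.
rewrite big_cons; case: ifPn => Pi.
  move=> [b Ab [c /IH[//|a Aa ->] <-]].
  exists (fun j => if j == i then b else a j) => [j|].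
    rewrite inE; case: eqVneq => [-> _ _ //|_ /= jr Pj]; exact: Aa.
  rewrite big_cons Pi eqxx; congr (_ + _).
  rewrite big_seq_cond [RHS]big_seq_cond; apply: eq_bigr => j /andP[jr _].
  by case: eqVneq jr ir => // -> ->.
move=> /IH[//|a Aa ->]; exists a; last by rewrite big_cons (negPf Pi).
by move=> j; rewrite inE => /orP[/eqP ->|/Aa//]; rewrite (negPf Pi).
Qed.

(** The factor is absorbed by the scalars [tk]; the points and subgradients are kept. *)
Lemma horizon_subdiffZ (R : realType) (n : nat) (h : 'rV[R]_n -> \bar R)
    (x w : 'rV[R]_n) (c : R) :
  0 < c -> horizon_subdiff h x w -> horizon_subdiff h x (c *: w).
Proof.
move=> c0 [xk [vk [tk [[xx hx vh] [t0 tk0 tw]]]]].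
exists xk, vk, (fun k => c * tk k); split=> //; split.
- by move=> k; rewrite mulr_gt0.
- by rewrite -[X in _ --> X](mulr0 c); apply: cvgM => //; exact: cvg_cst.
- under eq_fun do rewrite -scalerA; apply: cvgZ => //; exact: cvg_cst.
Qed.

(** Brings membership into the form in which the qualification condition is stated. *)
Lemma multiplier_sumP (R : realType) (n : nat) (I : finType)
    (g : I -> 'rV[R]_n -> \bar R) (K : I -> set 'rV[R]_n) (beta gamma : I -> R)
    (x : 'rV[R]_n) (mu : I -> R) (z : 'rV[R]_n) :
  multiplier_sum g K beta gamma x mu z <->
  exists v vinf : I -> 'rV[R]_n,
    [/\ forall j, active g x j -> 0 < mu j ->
          strong_subdiff (K j) (beta j) (gamma j) (g j) x (v j),
        forall j, active g x j -> mu j = 0 -> horizon_subdiff (g j) x (vinf j) &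
        z = \sum_(j | active g x j && (0 < mu j)) mu j *: v j
              + \sum_(j | active g x j && (mu j == 0)) vinf j].
Proof.
split=> [[_ /big_minkowski_sumP[a Aa ->] [_ /big_minkowski_sumP[b Bb ->] <-]]|].
  have /choice[v vP] j : exists v, active g x j && (0 < mu j) ->
      strong_subdiff (K j) (beta j) (gamma j) (g j) x v /\ mu j *: v = a j.
    case: (boolP (active g x j && (0 < mu j))) => [/Aa[v vj va]|_].
      by exists v.
    by exists 0.
  exists v, b; split=> [j gj mj|j gj mj|].
  - by apply: (vP j _).1; rewrite gj.
  - by apply: Bb; rewrite gj mj eqxx.
  - by congr (_ + _); apply: eq_bigr => j /vP[].
move=> [v [b [vP bP ->]]].
exists (\sum_(j | active g x j && (0 < mu j)) mu j *: v j).
  apply/big_minkowski_sumP; exists (fun j => mu j *: v j) => // j /andP[gj mj].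
  by exists (v j) => //; exact: vP.
exists (\sum_(j | active g x j && (mu j == 0)) b j) => //.
by apply/big_minkowski_sumP; exists b => // j /andP[gj /eqP mj]; exact: bP.
Qed.

(** A positive factor preserves which multipliers vanish. It passes into the coefficients of the
    strong subgradients and into the horizon vectors themselves. *)
Lemma multiplier_sumZ (R : realType) (n : nat) (I : finType)
    (g : I -> 'rV[R]_n -> \bar R) (K : I -> set 'rV[R]_n) (beta gamma : I -> R)
    (x : 'rV[R]_n) (mu : I -> R) (c : R) (z : 'rV[R]_n) :
  0 < c -> multiplier_sum g K beta gamma x mu z ->
  multiplier_sum g K beta gamma x (fun j => c * mu j) (c *: z).
Proof.
move=> c0 /multiplier_sumP[v [b [vP bP ->]]]; apply/multiplier_sumP.
have mu0 j : (c * mu j == 0) = (mu j == 0) by rewrite mulf_eq0 gt_eqF.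
exists v, (fun j => c *: b j); split=> [j gj|j gj /eqP|].
- by rewrite pmulr_rgt0//; exact: vP.
- by rewrite mu0 => /eqP mj; apply: horizon_subdiffZ => //; exact: bP.
rewrite scalerDr !scaler_sumr; congr (_ + _); apply: eq_big => j //.
- by rewrite pmulr_rgt0.
- by rewrite scalerA.
- by rewrite mu0.
Qed.

(** * The generalized KKT condition *)

Unset Implicit Arguments.

Theorem theorem5 (R : realType) (n : nat) (I : finType)
    (f : 'rV[R]_n -> \bar R) (g : I -> 'rV[R]_n -> \bar R)
    (xbar : 'rV[R]_n)
    (K : I -> set 'rV[R]_n) (beta gamma : I -> R)
    (f_proper : proper_fun f)
    (f_lsc : lower_semicontinuous f)
    (Omega_closed : closed (feasible_set g))
    (Omega_convex : convex_set (feasible_set g))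
    (xbar_feasible : feasible_set g xbar)
    (xbar_dom : domain f xbar)
    (xbar_locmin : \forall y \near xbar, feasible_set g y -> (f xbar <= f y)%E)
    (K_xbar : forall j, K j xbar)
    (beta_gt0 : forall j, 0 < beta j)
    (gamma_ge0 : forall j, 0 <= gamma j)
    (normal_cone_eq :
      normal_cone (feasible_set g) xbar =
      \bigcup_(mu in [set mu : I -> R | forall j, active g xbar j -> 0 <= mu j])
        multiplier_sum g K beta gamma xbar mu)
    (qualification :
      forall (mu : I -> R) (w : 'rV[R]_n) (v vinf : I -> 'rV[R]_n),
        (forall j, active g xbar j -> 0 <= mu j) ->
        horizon_subdiff f xbar w ->
        (forall j, active g xbar j -> 0 < mu j ->
           strong_subdiff (K j) (beta j) (gamma j) (g j) xbar (v j)) ->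
        (forall j, active g xbar j -> mu j = 0 ->
           horizon_subdiff (g j) xbar (vinf j)) ->
        0 = w + \sum_(j | active g xbar j && (0 < mu j)) mu j *: v j
              + \sum_(j | active g xbar j && (mu j == 0)) vinf j ->
        [/\ w = 0,
            forall j, active g xbar j -> ~~ (0 < mu j) &
            forall j, active g xbar j -> mu j = 0 -> vinf j = 0]) :
  exists (gamma0 : R) (mu : I -> R),
    [/\ 0 < gamma0,
        forall j, active g xbar j -> 0 <= mu j,
        gamma0 + \sum_(j | active g xbar j) mu j = 1 &
        minkowski_sum (dilate_set gamma0 (limiting_subdiff f xbar))
             (multiplier_sum g K beta gamma xbar mu) 0].
Proof.
have sumE := multiplier_sumP g K beta gamma xbar.
have [w hw|v fv] := limiting_fermat f_proper.2 f_lsc Omega_closed xbar_feasible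
    xbar_dom xbar_locmin.
  (* Decomposing the normal vector [- w] writes [w + (- w) = 0] as the relation in the qualification
     condition, which yields [w = 0]. *)
  rewrite normal_cone_eq => -[mu mu0 /sumE[v [b [vP bP wE]]]].
  by have [] := qualification mu w v b mu0 hw vP bP; rewrite // -addrA -wE subrr.
rewrite normal_cone_eq => -[mu mu0 muv].
have S0 : 0 <= \sum_(j | active g xbar j) mu j by exact: sumr_ge0.
(* The multiplier of [f] is 1 before normalisation, so dividing by the total mass makes the
   multipliers sum to 1 and keeps that of [f] positive. *)
pose c := (1 + \sum_(j | active g xbar j) mu j)^-1.
have c0 : 0 < c by rewrite invr_gt0; lra.
exists c, (fun j => c * mu j); split=> //.
- by move=> j gj; rewrite mulr_ge0 ?(ltW c0)// mu0.
- by rewrite -mulr_sumr -{1}(mulr1 c) -mulrDr mulVf// gt_eqF//; lra.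
exists (c *: v); first by exists v.
exists (c *: - v); first exact: multiplier_sumZ.
by rewrite scalerN subrr.
Qed.
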